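(* Let $\Gamma$ be a group generated by a finite symmetric set $S = S^{-1} \subset \Gamma$. For any non-empty finite subset $D \subset \Gamma$ and any real number $\lambda$ such that $1 < \lambda \leq \frac{\operatorname{Card}(\Gamma)}{\operatorname{Card}(D)}$ (if $\Gamma$ is infinite, this means any real $\lambda > 1$), we have $$\operatorname{Card}(\partial_S D) \geq \left(1 - \frac{1}{\lambda}\right) \frac{\operatorname{Card}(D)}{\phi_S(\lambda \operatorname{Card}(D))}.$$
   Context: $\mathbb{N}$ denotes the non-negative integers (including $0$). For a group $\Gamma$ with identity $e$ generated by a finite symmetric set $S = S^{-1}$, $B_S(n) \subset \Gamma$ is the set of elements that can be written as a product of at most $n$ generators in $S$ (so $B_S(0) = \{e\}$). The growth function is $\gamma_S(n) = \operatorname{Card}(B_S(n))$ for $n \in \mathbb{N}$. The boundary of a non-empty finite subset $D \subset \Gamma$ is the interior boundary with respect to left multiplication by generators: $$\partial_S D = \{x \in D \mid \exists s \in S \text{ such that } sx \notin D\}.$$ The reverse growth function is $$\phi_S(t) = \min\{n \in \mathbb{N} \mid \gamma_S(n) \geq t\},$$ for real $t \geq 0$ (defined for all $t \geq 0$ if $\Gamma$ is infinite, and for $0 \le t \leq \operatorname{Card}(\Gamma)$ if $\Gamma$ is finite). *)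

(* Defs.v *)
From HB Require Import structures.
From mathcomp Require Import all_boot all_order all_algebra finmap.
From mathcomp Require Import boolp classical_sets functions cardinality reals.
Set Implicit Arguments.
Unset Strict Implicit.
Unset Printing Implicit Defensive.
Import Order.TTheory GRing.Theory Num.Theory.
Local Open Scope fset_scope.
Local Open Scope classical_set_scope.
Local Open Scope ring_scope.

(* S = S^-1; not to be confused with [symmetric] for relations. *)
Definition sym_genset (G : groupType) (S : {fset G}) : Prop :=
  [fset (s^-1)%g | s in S] = S.

(* Under classical logic [{pred G}] ranges over all subsets of [G]. *)
Definition generates (G : groupType) (S : {fset G}) : Prop :=
  forall H : {pred G},
    group_closed H -> {subset S <= H} -> forall x : G, x \in H.

Definition word_ball (G : groupType) (S : {fset G}) (n : nat) : set G :=
  [set x | exists w : seq G,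
    [/\ (size w <= n)%N, {subset w <= S} & x = (\prod_(s <- w) s)%g]].

(* [fset_set] is only meaningful on finite sets; see [word_ball_finite]. *)
Definition growth (G : groupType) (S : {fset G}) (n : nat) : nat :=
  #|` fset_set (word_ball S n)|.

Definition inner_boundary (G : groupType) (S D : {fset G}) : {fset G} :=
  [fset x in D | [exists s : S, (val s * x)%g \notin D]].

(* The value 0 when no such [n] exists is a junk value: the minimum exists for
   every [t] if [G] is infinite and for [t <= Card G] if [G] is finite, see
   [reverse_growth_defined]. *)
Definition reverse_growth (R : realType) (G : groupType) (S : {fset G})
    (t : R) : nat :=
  if pselect (exists n : nat, t <= (growth S n)%:R) is left t_le
  then ex_minn t_le else 0%N.

Lemma word_ball0 (G : groupType) (S : {fset G}) : word_ball S 0 = [set 1%g].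
Proof.
apply/seteqP; split=> x /=.
  by move=> [[|s w] [//= _ _ ->]]; rewrite big_nil.
by move=> ->; exists [::]; rewrite big_nil.
Qed.

Lemma word_ballS (G : groupType) (S : {fset G}) (m n : nat) :
  (m <= n)%N -> word_ball S m `<=` word_ball S n.
Proof. by move=> mn x [w [wm wS ->]]; exists w; split=> //; apply: leq_trans mn. Qed.

Lemma word_ball_finite (G : groupType) (S : {fset G}) (n : nat) :
  finite_set (word_ball S n).
Proof.
elim: n => [|n IHn]; first by rewrite word_ball0; exact: finite_set1.
pose P := [set (p.1 * p.2)%g | p in [set` S] `*` word_ball S n].
apply: (@sub_finite_set _ _ ([set 1%g] `|` P)); last first.
  rewrite finite_setU; split; first exact: finite_set1.
  by apply: finite_image; apply: finite_setX => //; exact: finite_fset.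
move=> x [[|s w] [/= wn wS ->]]; first by left; rewrite big_nil.
right; exists (s, (\prod_(t <- w) t)%g) => /=; last by rewrite big_cons.
split=> /=; first by apply: wS; rewrite mem_head.
by exists w; split=> // t tw; apply: wS; rewrite in_cons tw orbT.
Qed.

Lemma growth0 (G : groupType) (S : {fset G}) : growth S 0 = 1%N.
Proof. by rewrite /growth word_ball0 fset_set1 cardfs1. Qed.

Lemma generates_word_ball (G : groupType) (S : {fset G}) (x : G) :
  sym_genset S -> generates S -> exists n, word_ball S n x.
Proof.
move=> Ssym Sgen.
pose H : {pred G} := [pred y | `[< exists n, word_ball S n y >]].
suff : x \in H by move/asboolP.
apply: Sgen; last first.
  move=> s sS; apply/asboolP; exists 1%N, [:: s]; rewrite big_seq1.
  by split=> // t; rewrite mem_seq1 => /eqP ->.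
split; first by apply/asboolP; exists 0%N; rewrite word_ball0.
move=> y z /asboolP[m [v [_ vS ->]]] /asboolP[n [w [_ wS ->]]].
apply/asboolP; exists (size (v ++ rev [seq (s^-1)%g | s <- w])).
exists (v ++ rev [seq (s^-1)%g | s <- w]); split=> //.
  move=> s; rewrite mem_cat mem_rev => /orP[/vS //|/mapP[t tw ->]].
  by rewrite -Ssym; apply/imfsetP; exists t => //; apply: wS.
rewrite big_cat /=; congr (_ * _)%g.
by rewrite -map_rev big_map prodgV revK.
Qed.

Lemma reverse_growthP (R : realType) (G : groupType) (S : {fset G}) (t : R) :
  (exists n, t <= (growth S n)%:R) ->
  t <= (growth S (reverse_growth S t))%:R /\
  forall n, t <= (growth S n)%:R -> (reverse_growth S t <= n)%N.
Proof.
by rewrite /reverse_growth => ex_t; case: pselect => // h; case: ex_minnP.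
Qed.

Lemma reverse_growth_defined (R : realType) (G : groupType) (S : {fset G})
    (t : R) :
  sym_genset S -> generates S ->
  (finite_set [set: G] -> t <= #|` fset_set [set: G]|%:R) ->
  exists n, t <= (growth S n)%:R.
Proof.
move=> Ssym Sgen tG.
have ball_fset (A : {fset G}) : exists n, (#|` A| <= growth S n)%N.
  suff [n An] : exists n, [set` A] `<=` word_ball S n.
    exists n; apply: fsubset_leq_card; apply/fsubsetP => x xA.
    by rewrite in_fset_set ?inE; [exact: An|exact: word_ball_finite].
  elim/finSet_rect: A => A IHA.
  have [->|[a aA]] := fset_0Vmem A; first by exists 0%N => x /=; rewrite inE.
  have [|n An] := IHA (A `\ a)%fset; first by rewrite fproperD1.
  have [m am] := generates_word_ball a Ssym Sgen.
  exists (maxn m n) => x /= xA; have [->|xa] := eqVneq x a.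
    exact: word_ballS (leq_maxl _ _) _ am.
  by apply: word_ballS (leq_maxr _ _) _ _; apply: An; rewrite /= !inE xa.
have [/tG tG'|Ginf] := pselect (finite_set [set: G]).
  by have [n Gn] := ball_fset (fset_set [set: G]);
     exists n; rewrite (le_trans tG') // ler_nat.
have [A _ At] := infinite_set_fset (Num.truncn t).+1 Ginf.
have [n An] := ball_fset A; exists n.
by apply/ltW/(lt_le_trans (truncnS_gt t)); rewrite ler_nat (leq_trans At).
Qed.

(* Main.v *)
Require Import Defs.
From mathcomp Require Import all_boot all_order all_algebra finmap.
From mathcomp Require Import boolp classical_sets functions cardinality reals.
Local Open Scope fset_scope.
Local Open Scope classical_set_scope.
Local Open Scope ring_scope.

Import Order.TTheory GRing.Theory Num.Theory.

(** For [g] in the group, count the points [x] of [D] that left translation by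
    [g] pushes out of [D], and write [d], [b], [e], [n] for the cardinals of
    [D], of the ball of radius [n] and of the boundary, and for the radius.

    Upper bound, for each [g] in the ball ([card_escape_word]): write [g] as a
    product of at most [n] generators and apply them to [x] one after the
    other. The path starts in [D] and ends outside, so one of its steps leaves
    [D], necessarily from a boundary point. The boundary point together with
    the index of the step determines [x], so at most [n * e] points of [D]
    escape under [g].

    Lower bound, on average over the ball ([sum_card_escape]): for fixed [x],
    the translates [g * x] are distinct, so at most [d] elements [g] of the ball
    keep [x] inside [D]. Hence at least [d * (b - d)] pairs [(g, x)] escape.

    Comparing, [d * (b - d) <= b * n * e]. With [n] the reverse growth function
    at [lambda * d], the ball satisfies [b >= lambda * d], and
    [(1 - 1 / lambda) * d <= (1 - d / b) * d <= n * e]. *)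

Definition escape {G : groupType} (D : {fset G}) (g : G) : {fset G} :=
  [fset x in D | (g * x)%g \notin D].

Lemma in_fset_sep {K : choiceType} (A : {fset K}) (P : pred K) (x : K) :
  (x \in [fset x in A | P x]) = (x \in A) && P x.
Proof. by rewrite !inE. Qed.

Lemma card_fset_sep {K : choiceType} (A : {fset K}) (P : pred K) :
  #|` [fset x in A | P x]| = (\sum_(x <- A) P x)%N.
Proof.
rewrite -big_mkcond /= sum1_count -size_filter; apply: perm_size.
apply: uniq_perm; rewrite ?filter_uniq ?fset_uniq // => x.
by rewrite mem_filter !inE andbC.
Qed.

Lemma sum_fset_const {K : choiceType} (A : {fset K}) (n : nat) :
  (\sum_(x <- A) n = #|` A| * n)%N.
Proof. by rewrite big_const_seq count_predT iter_addn_0 mulnC. Qed.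

Lemma inner_boundaryP {G : groupType} {S D : {fset G}} {s x : G} :
  s \in S -> x \in D -> (s * x)%g \notin D -> x \in inner_boundary S D.
Proof.
by move=> sS xD sxD; rewrite !inE xD; apply/existsP; exists (FSetSub sS).
Qed.

(** Induction on the word: a point that [s * g] moves out of [D] was already
    outside after [g], or [g] sends it, injectively, to a boundary point. *)
Lemma card_escape_word {G : groupType} (S D : {fset G}) (w : seq G) :
  {subset w <= S} ->
  (#|` escape D (\prod_(s <- w) s)%g| <= size w * #|` inner_boundary S D|)%N.
Proof.
elim: w => [|s w IHw] wS.
  rewrite big_nil leqn0 cardfs_eq0; apply/eqP/fsetP => x.
  by rewrite !inE mul1g andbN.
rewrite big_cons; set g := (\prod_(t <- w) t)%g.
pose A := [fset x in D | (g * x)%g \in inner_boundary S D].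
have escape_sub : (escape D (s * g)%g `<=` escape D g `|` A)%fset.
  apply/fsubsetP => x; rewrite in_fsetU !(in_fset_sep _ _ x) -mulgA.
  case/andP=> xD sgxD; rewrite xD /=.
  case: (boolP (g * x \in D)%g) => //= gxD.
  exact: inner_boundaryP (wS s (mem_head _ _)) gxD sgxD.
apply: leq_trans (fsubset_leq_card escape_sub) _.
apply: leq_trans (leq_card_fsetU _ _) _.
rewrite /= mulSn addnC leq_add //; last first.
  by apply: IHw => t tw; apply: wS; rewrite inE tw orbT.
rewrite -(card_imfset imfset_key (mem A) (mulgI g)).
apply: fsubset_leq_card; apply/fsubsetP => y /imfsetP[x /= xA ->].
by move: xA; rewrite [_ \in _]in_fset_sep => /andP[].
Qed.

Lemma card_translate_in {G : groupType} (B D : {fset G}) (x : G) :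
  (#|` [fset g in B | (g * x)%g \in D]| <= #|` D|)%N.
Proof.
set A := [fset g in B | _].
rewrite -(card_imfset imfset_key (mem A) (mulIg x)).
apply: fsubset_leq_card; apply/fsubsetP => y /imfsetP[g /= gA ->].
by move: gA; rewrite [_ \in _]in_fset_sep => /andP[].
Qed.

(** Among the pairs [(g, x)] with [g] in [B] and [x] in [D], those with [g * x]
    in [D] contribute at most [#|` D|] for each [x]; the others are counted by
    the sum on the right. *)
Lemma sum_card_escape {G : groupType} (B D : {fset G}) :
  (#|` B| * #|` D| <= \sum_(g <- B) #|` escape D g| + #|` D| * #|` D|)%N.
Proof.
under eq_bigr => g _ do rewrite card_fset_sep.
have -> : (#|` B| * #|` D| = \sum_(x <- D) \sum_(g <- B) 1)%N.
  by rewrite !sum_fset_const muln1 mulnC.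
have -> : (#|` D| * #|` D| = \sum_(x <- D) #|` D|)%N.
  by rewrite sum_fset_const.
rewrite [X in (_ <= X + _)%N]exchange_big -big_split; apply: leq_sum => x _.
apply: leq_trans (leq_add (leqnn _) (card_translate_in B D x)).
rewrite card_fset_sep -big_split /=; apply: leq_sum => g _.
by case: (_ \in D).
Qed.

(** The double count over the ball of radius [n], with each escape set bounded
    by [card_escape_word]. Kept in natural numbers and free of subtraction, it
    holds for every [n], also when the ball is smaller than [D]. *)
Lemma growth_isoperimetry {G : groupType} (S D : {fset G}) (n : nat) :
  (growth S n * #|` D|
    <= growth S n * (n * #|` inner_boundary S D|) + #|` D| * #|` D|)%N.
Proof.
apply: leq_trans (sum_card_escape (fset_set (word_ball S n)) D) _.
rewrite leq_add2r -sum_fset_const big_seq [leqRHS]big_seq.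
apply: leq_sum => g; rewrite in_fset_set; last exact: word_ball_finite.
rewrite inE => -[w [wn wS ->]].
by apply: leq_trans (card_escape_word S D w wS) _; rewrite leq_mul2r wn orbT.
Qed.

Theorem theorem1 (R : realType) (G : groupType) (S D : {fset G}) (lambda : R)
    (S_sym : sym_genset S) (S_gen : generates S)
    (D_neq0 : D != fset0) (lambda_gt1 : 1 < lambda)
    (lambda_le : finite_set [set: G] ->
       lambda <= #|` fset_set [set: G]|%:R / #|` D|%:R) :
  (1 - 1 / lambda) *
    (#|` D|%:R / (reverse_growth S (lambda * #|` D|%:R))%:R)
  <= #|` inner_boundary S D|%:R.
Proof.
have d_gt0 : 0 < #|` D|%:R :> R by rewrite ltr0n cardfs_gt0.
have lambda_gt0 : 0 < lambda := lt_trans ltr01 lambda_gt1.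
have [|b_ge _] := @reverse_growthP R G S (lambda * #|` D|%:R).
  apply: reverse_growth_defined => // Gfin.
  by rewrite -ler_pdivlMr //; exact: lambda_le.
move: (reverse_growth _ _) b_ge => n b_ge.
have := growth_isoperimetry S D n.
rewrite -(ler_nat R) natrD !natrM; have := ler0n R #|` inner_boundary S D|.
move: #|` D|%:R (growth S n)%:R #|` inner_boundary S D|%:R d_gt0 b_ge.
move=> d b e d_gt0 b_ge e_ge0 count.
have b_gt0 : 0 < b by apply: lt_le_trans b_ge; rewrite mulr_gt0.
(* In radius [0] the left-hand side is [0], since [0^-1 = 0]. *)
have [->|n_gt0] := posnP n; first by rewrite invr0 !mulr0.
rewrite mulrA ler_pdivrMr ?ltr0n // mulrC div1r.
rewrite -(ler_pM2l b_gt0).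
apply: (@le_trans _ _ (b * d - d * d)); last first.
  by rewrite lerBlDr [e * _]mulrC.
rewrite mulrBr mulr1 mulrBr lerD2l lerN2 mulrCA ler_pM2l //.
by rewrite ler_pdivlMr // mulrC.
Qed.
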